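(* Let $\phi$ be a u-shaped function, and let $\mathcal{P}$ be a class of probability measures on $(\Omega,\mathcal{F})=(\mathbb{R}^{\mathbb{N}},\mathcal{B}(\mathbb{R})^{\mathbb{N}})$ such that (a) $\mathbb{P}_1=\mathbb{P}_2=\cdots$ for all $\mathbb{P}\in\mathcal{P}$, (b) $\lim_{K\to\infty}\sup_{\mathbb{P}\in\mathcal{P}}\int\phi(y)\mathbf{1}_{\{\phi(y)\ge K\}}\,\mathbb{P}_1(dy)=0$, (c) $\lim_{n\to\infty}\sup_{\mathbb{P}\in\mathcal{P}}\alpha_{\mathbb{P}}(n)=0$. Then, for every $\delta>0$, $$\lim_{n\to\infty}\ \sup_{\mathbb{P}\in\mathcal{P}}\ \mathbb{P}\bigl[d_{(\phi)}(\widehat m_n,\mathbb{P}_1)\ge\delta\bigr]=0.$$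
   Context: Here $\Omega:=\mathbb{R}^{\mathbb{N}}$ with the product $\sigma$-field $\mathcal{F}:=\mathcal{B}(\mathbb{R})^{\mathbb{N}}$, $X_i$ is the $i$th coordinate projection on $\Omega$, and $\mathbb{P}_i:=\mathbb{P}\circ X_i^{-1}$ is the $i$th marginal distribution of a probability measure $\mathbb{P}$ on $(\Omega,\mathcal{F})$. The empirical probability measure is $\widehat m_n(x):=\frac1n\sum_{i=1}^n\delta_{x_i}$ for $x=(x_1,x_2,\ldots)\in\Omega$. A u-shaped function is a continuous function $\phi:\mathbb{R}\to[1,\infty)$ that is nonincreasing on $(-\infty,0)$ and nondecreasing on $(0,\infty)$. The Kolmogorov $\phi$-metric is $d_{(\phi)}(\mu,\nu):=\sup_{y\in\mathbb{R}}|F_\mu(y)-F_\nu(y)|\,\phi(y)$, where $F_\mu$ is the distribution function of $\mu$; it is a metric on the set of all probability measures $\mu$ on $(\mathbb{R},\mathcal{B}(\mathbb{R}))$ with $d_{(\phi)}(\mu,\delta_0)<\infty$. The $n$th strong mixing coefficient of the coordinate process under $\mathbb{P}$ is $\alpha_{\mathbb{P}}(n):=\sup_{k\ge1}\sup_{A,B}|\mathbb{P}[A\cap B]-\mathbb{P}[A]\mathbb{P}[B]|$, where the inner supremum ranges over all $A\in\sigma(X_1,\ldots,X_k)$ and $B\in\sigma(X_{k+n},X_{k+n+1},\ldots)$. *)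

(* Defs.v *)
From HB Require Import structures.
From mathcomp Require Import all_boot all_order all_algebra.
From mathcomp Require Import all_classical all_reals all_analysis.

Set Implicit Arguments.
Unset Strict Implicit.
Unset Printing Implicit Defensive.

Import Order.TTheory GRing.Theory Num.Theory.
Import numFieldNormedType.Exports.

Local Open Scope classical_set_scope.
Local Open Scope ring_scope.

(* Sequences are indexed from 0: the coordinate X_i (i >= 1) of the
   mathematical text is the projection x |-> x i.-1. *)

Definition coord_system (R : realType) (I : set nat) : set (set (nat -> R)) :=
  \bigcup_(i in I) preimage_set_system setT (fun x : nat -> R => x i) measurable.
Arguments coord_system R I : clear implicits.

Definition sigma_coord (R : realType) (I : set nat) : set (set (nat -> R)) :=
  <<s coord_system R I >>.
Arguments sigma_coord R I : clear implicits.

(* R^N with the product sigma-algebra; its measurable sets are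
   sigma_coord R setT, by conversion. *)
Definition Omega (R : realType) := g_sigma_algebraType (coord_system R setT).
HB.instance Definition _ (R : realType) := Measurable.on (Omega R).

Definition coord (R : realType) (i : nat) (x : Omega R) : R := x i.

Lemma measurable_coord (R : realType) (i : nat) :
  measurable_fun setT (@coord R i).
Proof.
by move=> _ B mB; apply: sub_sigma_algebra; exists i => //; exists B.
Qed.

HB.instance Definition _ (R : realType) (i : nat) :=
  isMeasurableFun.Build _ _ (Omega R) R (@coord R i) (@measurable_coord R i).

Definition marginal (R : realType) (P : probability (Omega R) R) (i : nat) :
  probability R R := distribution P (@coord R i).

(* Equal to the zero measure for n = 0. *)
Definition empirical (R : realType) (n : nat) (x : Omega R) :
    {measure set R -> \bar R} :=
  mscale (n%:R^-1)%:nng (msum (fun i => \d_(coord i x)) n).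

Lemma empiricalE (R : realType) (n : nat) (x : Omega R) (A : set R) :
  empirical n x A = ((n%:R^-1)%:E * \sum_(i < n) \d_(coord i x) A)%E.
Proof. by []. Qed.

Lemma empirical_setT (R : realType) (n : nat) (x : Omega R) :
  (0 < n)%N -> empirical n x setT = 1%E.
Proof.
move=> n0; rewrite empiricalE; under eq_bigr do rewrite diracT.
by rewrite sumEFin sumr_const card_ord -EFinM mulVf// pnatr_eq0 -lt0n.
Qed.

Definition u_shaped (R : realType) (phi : R -> R) : Prop :=
  [/\ continuous phi,
      (forall y, 1 <= phi y),
      {in `]-oo, 0[ &, {homo phi : x y /~ x <= y}} &
      {in `]0, +oo[ &, {homo phi : x y / x <= y}}].

Definition kolmogorov_dist (R : realType) (phi : R -> R)
    (mu nu : {measure set R -> \bar R}) : \bar R :=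
  ereal_sup [set (`|mu `]-oo, y]%classic - nu `]-oo, y]%classic| * (phi y)%:E)%E
            | y in [set: R]].

(* X_{k+n}, X_{k+n+1}, ... are the projections j with k + n <= j.+1. *)
Definition alpha_mixing (R : realType) (P : probability (Omega R) R) (n : nat) :
    \bar R :=
  ereal_sup [set
    ereal_sup [set `|P (A `&` B) - P A * P B|%E
              | A in sigma_coord R [set i | (i < k)%N]
              & B in sigma_coord R [set j | (k + n <= j.+1)%N]]
    | k in [set k | (1 <= k)%N]].

(* Main.v *)
(** For a fixed Borel set A, the variance of sum_(i < n) 1_A(X_i) is a double sum
    of covariances; strong mixing makes those with |i - j| >= N uniformly small,
    so m_n(A) -> P_1(A) in probability, uniformly in P and A. Since rays are
    totally ordered by inclusion, boundedly many quantile rays of P_1 bracket all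
    of them, which gives the uniform convergence of the distribution functions and
    controls the weighted distance where phi < K. Where phi >= K, monotonicity of
    phi on each half-line bounds the weighted difference by the integrals of
    phi 1_{phi >= K} under m_n and P_1; both have the same expectation, which is
    small by uniform integrability, and Markov's inequality concludes. *)

Require Import Defs.
From mathcomp Require Import all_boot all_order all_algebra.
From mathcomp Require Import all_classical all_reals all_analysis.
From mathcomp Require Import measurable_realfun.
From mathcomp Require Import zify ring lra.
Import Order.TTheory GRing.Theory Num.Theory.
Import numFieldNormedType.Exports.
Local Open Scope classical_set_scope.
Local Open Scope ring_scope.

(** * Variance of sums of indicators and the weak law *)

Lemma covariance_sum_l {d} {T : measurableType d} {R : realType}
    (P : probability T R) (X : nat -> T -> R) (Y : T -> R) (n : nat) :
  (forall i, X i \in Lfun P 2%:E) -> Y \in Lfun P 2%:E ->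
  covariance P (\sum_(i < n) X i) Y = (\sum_(i < n) covariance P (X i) Y)%E.
Proof.
move=> X2 Y2; elim: n => [|n IH].
  by rewrite !big_ord0 covariance_cst_l.
rewrite !big_ord_recr/= covarianceDl ?IH//.
by rewrite rpred_sum// lee_fin ler1n.
Qed.

Lemma variance_sum {d} {T : measurableType d} {R : realType}
    (P : probability T R) (X : nat -> T -> R) (n : nat) :
  (forall i, X i \in Lfun P 2%:E) ->
  variance P (\sum_(i < n) X i) =
  (\sum_(i < n) \sum_(j < n) covariance P (X i) (X j))%E.
Proof.
move=> X2; rewrite /variance covariance_sum_l//; last first.
  by rewrite rpred_sum// lee_fin ler1n.
apply: eq_bigr => i _; rewrite covarianceC covariance_sum_l//.
by apply: eq_bigr => j _; rewrite covarianceC.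
Qed.

Lemma Lfun_indic {d} {T : measurableType d} {R : realType}
    (P : probability T R) (A : set T) (p : R) :
  1 <= p -> measurable A -> (\1_A : T -> R) \in Lfun P p%:E.
Proof.
move=> p1 mA; rewrite inE/=; apply/andP; split; rewrite inE//=.
rewrite /finite_norm unlock poweR_lty//.
under eq_integral => x _.
  rewrite /= (_ : `|\1_A x| `^ p = \1_A x); first over.
  rewrite ger0_norm// indicE; case: (x \in A); first by rewrite powR1.
  by rewrite powR0// gt_eqF// (lt_le_trans ltr01).
by rewrite integral_indic// setIT (le_lt_trans (probability_le1 P mA))// ltry.
Qed.

Lemma covariance_indic {d} {T : measurableType d} {R : realType}
    (P : probability T R) (A B : set T) : measurable A -> measurable B ->
  covariance P \1_A \1_B = (P (A `&` B) - P A * P B)%E.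
Proof.
move=> mA mB; have AB : (\1_A * \1_B : T -> R) = \1_(A `&` B).
  by rewrite indicI.
rewrite covarianceE ?AB ?expectation_indic//; [| | |];
  by rewrite ?Lfun_indic//; exact: measurableI.
Qed.

(** Each of the [n] rows meets the band of pairs at distance less than [N] in at most [N.*2]
    places. *)
Lemma sum_near_diag (n N : nat) :
  (\sum_(i < n) \sum_(j < n) ((i < j + N) && (j < i + N)) <= n * N.*2)%N.
Proof.
(* The second argument of [minn] carries the induction on [k]: entries of the band satisfy
   [i < j + N], so few are met while [k] is still close to [i - N]. *)
have row (i k : nat) :
    (\sum_(j < k) ((i < j + N) && (j < i + N)) <= minn N.*2 (k + N - i))%N.
  elim: k => [|k IH]; first by rewrite big_ord0.
  rewrite big_ord_recr/= -addnn; move: IH; rewrite -addnn.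
  set s := bigop _ _ _; move: s => s.
  by case: (boolP ((i < k + N) && _)%N) => /=; lia.
apply: (@leq_trans (\sum_(i < n) N.*2)%N); last by rewrite sum_nat_const card_ord.
by apply: leq_sum => i _; apply: leq_trans (row i n) _; exact: geq_minl.
Qed.

(** Chebyshev's inequality for the sum. Its variance is a double sum of covariances: far pairs
    contribute at most [e] each, and the at most [n * N.*2] near pairs at most [1] more, so it is at
    most [n ^ 2 * e + n * N.*2]. *)
Lemma weak_law_indic {d} {T : measurableType d} {R : realType}
    (P : probability T R) (A : nat -> set T) (p e eta : R) (N n : nat) :
  (forall i, measurable (A i)) -> (forall i, P (A i) = p%:E) ->
  0 <= e -> 0 < eta -> (0 < n)%N ->
  (forall i j, (i + N <= j)%N ->
    (P (A i `&` A j) - P (A i) * P (A j) <= e%:E)%E) ->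
  (P [set x | eta <= `|n%:R^-1 * \sum_(i < n) \1_(A i) x - p|]%R <=
   ((e + N.*2%:R / n%:R) / eta ^+ 2)%:E)%E.
Proof.
move=> mA PA e0 eta0 n0 cov_far.
have nR0 : 0 < n%:R :> R by rewrite ltr0n.
pose S : T -> R := \sum_(i < n) \1_(A i).
have SE x : S x = \sum_(i < n) \1_(A i) x by rewrite /S fct_sumE.
have L2 i : (\1_(A i) : T -> R) \in Lfun P 2%:E by rewrite Lfun_indic// ler1n.
have mS : measurable_fun setT S.
  rewrite (_ : S = fun x => \sum_(i < n) \1_(A i) x); last exact/funext.
  by apply: measurable_sum => i; exact: measurable_indic.
have ES : 'E_P[S]%E = (n%:R * p)%:E.
  rewrite unlock; under eq_integral do rewrite SE -sumEFin.
  rewrite ge0_integral_sum//=; last first.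
  - by move=> i; exact/measurable_EFinP/measurable_indic.
  rewrite (eq_bigr (fun=> p%:E)); last first.
    by move=> i _; rewrite -(PA i) -[in RHS](setIT (A i)) -integral_indic.
  by rewrite sumEFin sumr_const card_ord mulr_natl.
have VS : ('V_P[S] <= (n%:R ^+ 2 * e + (n * N.*2)%:R)%:E)%E.
  have cov_le (i j : 'I_n) : (covariance P \1_(A i) \1_(A j) <=
      (e + ((i < j + N) && (j < i + N))%N%:R)%:E)%E.
    rewrite covariance_indic//; have [near|] := boolP (_ && _).
      rewrite (@le_trans _ _ 1%E)//; last by rewrite lee_fin lerDr.
      rewrite leeBlDr ?PA// (@le_trans _ _ 1%E)//.
        by rewrite probability_le1//; exact: measurableI.
      by rewrite leeDl// -EFinM lee_fin -expr2 sqr_ge0.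
    rewrite addr0 negb_and -!leqNgt => /orP[ji|ij]; last exact: cov_far.
    by rewrite setIC muleC cov_far.
  rewrite (variance_sum P (fun i => \1_(A i)) n L2).
  apply: (@le_trans _ _ (\sum_(i < n) \sum_(j < n)
      (e + ((i < j + N) && (j < i + N))%N%:R)%:E)%E).
    by apply: lee_sum => i _; apply: lee_sum => j _; exact: cov_le.
  under eq_bigr do rewrite sumEFin.
  rewrite sumEFin lee_fin; under eq_bigr do rewrite big_split/=.
  rewrite big_split/= !sumr_const card_ord -mulrnA -[e *+ _]mulr_natl mulnn natrX.
  rewrite lerD2l.
  under eq_bigr do rewrite -natr_sum.
  by rewrite -natr_sum ler_nat sum_near_diag.
pose X : {mfun T >-> R} := mfun_Sub (mem_set mS).
(* The level [n * eta] for the sum is the level [eta] for the average. *)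
have /= := @chebyshev _ _ _ P X (n%:R * eta) (mulr_gt0 nR0 eta0).
rewrite ES/= (_ : [set x | _] =
    [set x | eta <= `|n%:R^-1 * \sum_(i < n) \1_(A i) x - p|]); last first.
  apply: eq_set => x; rewrite SE -(ler_pM2l nR0 eta) -[X in X * `|_|]gtr0_norm//.
  by rewrite -normrM mulrBr mulVKf ?gt_eqF.
move=> /le_trans; apply.
apply: le_trans (lee_wpmul2l _ VS) _.
  by rewrite lee_fin invr_ge0 exprn_ge0// mulr_ge0// ltW.
rewrite -EFinM lee_fin le_eqVlt; apply/orP; left; apply/eqP.
rewrite natrM; field.
by rewrite !gt_eqF.
Qed.

(** * Quantile rays of a distribution *)

(* With t = inf {y | c <= F y}: U = ]-oo, t[ and V = ]-oo, t]. *)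
Lemma cdf_quantile_bracket {d} {T : measurableType d} {R : realType}
    (P : probability T R) (X : {RV P >-> R}) (c : R) : 0 <= c ->
  exists U V : set R, [/\ measurable U /\ measurable V,
    (distribution P X U <= c%:E)%E,
    c <= 1 -> (c%:E <= distribution P X V)%E,
    forall y, (cdf X y < c%:E)%E -> `]-oo, y] `<=` U &
    forall y, (c%:E <= cdf X y)%E -> V `<=` `]-oo, y] ].
Proof.
move=> c0; pose F (y : R) := fine (cdf X y).
have FE u : cdf X u = (F u)%:E by rewrite fineK// fin_num_measure.
have Fmono : {homo F : x y / x <= y}.
  by move=> x y xy; rewrite -lee_fin -!FE cdf_nondecreasing.
(* At [c = 0] every [y] reaches the level, which corresponds to [t = -oo]: both rays are empty. *)
have [->|c_neq0] := eqVneq c 0.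
  exists set0, set0; split=> // [|y|y _]; first by rewrite measure0.
    by rewrite ltNge cdf_ge0.
  exact: sub0set.
have {c_neq0} c_gt0 : 0 < c by rewrite lt_neqAle eq_sym c_neq0.
(* If [F] never reaches [c], then [t = +oo] and both rays are the whole line; since [F] tends to 1,
   this forces [1 <= c]. *)
have [[z0 z0c]|Fc] := pselect (exists z, c <= F z); last first.
  have {}Fc y : F y < c by rewrite ltNge; apply/negP => cF; apply: Fc; exists y.
  exists setT, setT; split => //.
  - rewrite probability_setT lee_fin.
    have Fy1 : F y @[y --> +oo] --> (1 : R) by exact/fine_cvg/cvg_cdfy1.
    apply: (cvgr_to_le Fy1); near=> r; exact/ltW.
  - by move=> c1; rewrite probability_setT lee_fin.
  - by move=> y; rewrite FE lee_fin leNgt Fc.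
have FNy0 : F y @[y --> -oo] --> (0 : R) by exact/fine_cvg/cvg_cdfNy0.
have [M [_ FM]] := cvgr_lt _ FNy0 _ c_gt0.
pose Y := [set y | c <= F y].
have Ylb : has_lbound Y.
  by exists M => y /= cFy; rewrite leNgt; apply/negP => /FM; rewrite ltNge cFy.
have Yinf : has_inf Y by split => //; exists z0.
pose t := inf Y.
(* Right continuity of [F] shows that the infimum is attained, whence the equivalence [Yt]. *)
have ct : c <= F t.
  have Frc : F y @[y --> t^'+] --> F t.
    by apply: fine_cvg; rewrite -FE; exact: cdf_right_continuous.
  apply: (cvgr_to_ge Frc); near=> r.
  have tr : t < r by near: r; exact: nbhs_right_gt.
  have [z cz] : exists2 z, Y z & z < inf Y + (r - t).
    by apply: inf_adherent => //; rewrite subr_gt0.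
  by rewrite -/t addrC subrK => zr; rewrite (le_trans cz)// Fmono// ltW.
have Yt y : (c <= F y) = (t <= y).
  apply/idP/idP => [cy|ty]; first exact: ge_inf.
  by rewrite (le_trans ct)// Fmono.
exists `]-oo, t[%classic, `]-oo, t]%classic; split => //.
(* Continuity from below: the open ray is an increasing union of closed rays ending before [t], each
   of mass less than [c]. *)
- have -> : `]-oo, t[%classic = \bigcup_n `]-oo, t - n.+1%:R^-1]%classic.
    apply/seteqP; split => x /=; rewrite in_itv/=.
      move=> /ltr_add_invr[k xk]; exists k => //=.
      by rewrite in_itv/= lerBrDr ltW.
    move=> [k _] /=; rewrite in_itv/= => /le_lt_trans; apply.
    by rewrite ltrBlDr ltrDl.
  apply: (cvge_to_le (nondecreasing_cvg_mu _ _ _)).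
  + by move=> k; exact: measurable_itv.
  + by apply: bigcup_measurable => k _; exact: measurable_itv.
  + move=> k l kl; apply/subsetPset/subset_itvl.
    by rewrite bnd_simp lerD2l lerN2 lef_pV2 ?posrE// ler_nat.
  + near=> k; rewrite /= -/(cdf X _) FE lee_fin ltW// ltNge Yt -ltNge.
    by rewrite ltrBlDr ltrDl.
- by rewrite -/(cdf X t) FE lee_fin.
- move=> y; rewrite FE lte_fin ltNge Yt -ltNge => yt x /=.
  by rewrite !in_itv/= => /le_lt_trans; exact.
- move=> y; rewrite FE lee_fin Yt => ty x /=.
  by rewrite !in_itv/= => /le_trans; exact.
Unshelve. all: by end_near.
Qed.

(** * The weighted distance where the weight is large *)

Lemma empirical_mean {R : realType} (n : nat) (x : Omega R) (A : set R) :
  empirical n x A = (n%:R^-1 * \sum_(i < n) \1_A (x i))%:E.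
Proof. by rewrite empiricalE EFinM -sumEFin. Qed.

Definition upper_part {R : realType} (phi : R -> R) (K y : R) : R :=
  phi y * \1_[set z | K <= phi z] y.

(** [T] is the ray from [y] pointing away from 0; by monotonicity [phi] is at least [phi y], hence
    at least [K], all along it. *)
Lemma u_shaped_tail {R : realType} (phi : R -> R) (K y : R) :
  u_shaped phi -> K <= phi y ->
  exists T : set R, (T = `]-oo, y]%classic \/ T = ~` `]-oo, y]%classic) /\
    forall x, phi y * \1_T x <= upper_part phi K x.
Proof.
move=> [phic phi1 phiN phiP] Ky.
have phi0 z : 0 <= phi z by exact: le_trans (phi1 z).
have dominate (T : set R) : (forall x, T x -> phi y <= phi x) ->
    forall x, phi y * \1_T x <= upper_part phi K x.
  move=> yT x; rewrite /upper_part !indicE; have [/set_mem Tx|_] := boolP (x \in T).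
    by rewrite mem_set/= ?mulr1 ?yT// (le_trans Ky)// yT.
  by rewrite mulr0 mulr_ge0.
have [y0|y0] := ltP y 0.
  exists `]-oo, y]%classic; split; first by left.
  apply: dominate => x /=; rewrite in_itv/= => xy.
  by apply: phiN; rewrite ?in_itv//= (le_lt_trans xy).
exists (~` `]-oo, y]%classic); split; first by right.
apply: dominate => x /=; rewrite in_itv/= => /negP; rewrite -ltNge => yx.
have xpos : 0 < x by exact: le_lt_trans yx.
move: y0; rewrite le_eqVlt => /predU1P[<-|ypos]; last first.
  by apply: phiP; rewrite ?in_itv/= ?ypos ?xpos// ltW.
(* For [y = 0], monotonicity on the open half-line says nothing about [phi 0] itself; continuity
   from the right supplies the comparison. *)
have phi_right : phi u @[u --> 0^'+] --> phi 0.
  exact/cvg_at_right_filter/phic.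
apply: (cvgr_to_le phi_right); near=> u.
have u0 : 0 < u by near: u; exact: nbhs_right_gt.
have ux : u < x by near: u; exact: nbhs_right_lt.
by apply: phiP; rewrite ?in_itv/= ?u0 ?xpos// ltW.
Unshelve. all: by end_near.
Qed.

Lemma measurable_upper_part {R : realType} (phi : R -> R) (K : R) :
  u_shaped phi -> measurable_fun setT (upper_part phi K).
Proof.
move=> [phic _ _ _].
have mphi : measurable_fun setT phi by exact: continuous_measurable_fun.
apply: measurable_funM => //; apply: measurable_indic.
rewrite -[X in measurable X]setTI.
by apply: measurable_fun_le => //; exact: measurable_cst.
Qed.

(** The difference of two distribution functions at [y] is at most the sum of the masses of the tail
    [T], on whichever side it lies. Multiplied by [phi y], each mass is at most the integral of
    [upper_part phi K]. *)
Lemma le_cdf_dist_tail {R : realType} (phi : R -> R) (mu : probability R R)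
    (K y : R) (n : nat) (x : Omega R) : u_shaped phi -> (0 < n)%N -> K <= phi y ->
  ((`|empirical n x `]-oo, y]%classic - mu `]-oo, y]%classic| * (phi y)%:E) <=
   (n%:R^-1 * \sum_(i < n) upper_part phi K (x i))%:E +
   \int[mu]_z (upper_part phi K z)%:E)%E.
Proof.
move=> phiU n0 Ky; pose g := upper_part phi K.
have nV0 : 0 <= n%:R^-1 :> R by rewrite invr_ge0.
have [_ phi1 _ _] := phiU.
have phi0 z : 0 <= phi z by exact: le_trans (phi1 z).
have [T [TE Tg]] := u_shaped_tail _ _ _ phiU Ky.
have mI : measurable `]-oo, y]%classic by exact: measurable_itv.
have mT : measurable T.
  by case: TE => ->//; exact: measurableC.
have muT : ((fine (mu T) * phi y)%:E <= \int[mu]_z (g z)%:E)%E.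
  rewrite EFinM fineK ?fin_num_measure// muleC.
  rewrite -[X in (_ * mu X)%E](setIT T) -integral_indic//.
  rewrite -ge0_integralZl ?lee_fin//; last exact/measurable_EFinP/measurable_indic.
  apply: ge0_le_integral => //.
  - by move=> z _; rewrite -EFinM lee_fin mulr_ge0.
  - apply: measurable_funeM; exact/measurable_EFinP/measurable_indic.
  - apply/measurable_EFinP; exact: measurable_upper_part.
  - by move=> z _; rewrite -EFinM lee_fin Tg.
have empT : n%:R^-1 * (\sum_(i < n) \1_T (x i)) * phi y <=
    n%:R^-1 * \sum_(i < n) g (x i).
  rewrite -mulrA ler_wpM2l// mulr_suml; apply: ler_sum => i _.
  by rewrite mulrC Tg.
have emp_ge0 : 0 <= n%:R^-1 * (\sum_(i < n) \1_T (x i)) :> R.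
  by rewrite mulr_ge0// sumr_ge0.
have muT0 : 0 <= fine (mu T) by rewrite fine_ge0.
apply: (@le_trans _ _ ((n%:R^-1 * (\sum_(i < n) \1_T (x i)) * phi y)%:E +
    (fine (mu T) * phi y)%:E)%E); last by rewrite leeD// lee_fin.
rewrite empirical_mean -[mu _]fineK ?fin_num_measure// -EFinB abse_EFin.
rewrite -EFinM -EFinD lee_fin -mulrDl ler_wpM2r//.
have nR0 : n%:R != 0 :> R by rewrite pnatr_eq0 -lt0n.
case: TE => TE; rewrite TE in emp_ge0 muT0 *.
  by rewrite (le_trans (ler_normB _ _))// !ger0_norm.
(* When [T] is the right tail, complements are taken; total mass 1 of the empirical measure uses
   [0 < n]. *)
have muC : fine (mu (~` `]-oo, y]%classic)) = 1 - fine (mu `]-oo, y]%classic).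
  by rewrite probability_setC// fineB ?fin_num_measure.
have empC : n%:R^-1 * (\sum_(i < n) \1_(~` `]-oo, y]%classic) (x i)) =
    1 - n%:R^-1 * (\sum_(i < n) \1_(`]-oo, y]%classic) (x i)) :> R.
  under eq_bigr => i _.
    rewrite (_ : \1_(~` _) _ = 1 - \1_(`]-oo, y]%classic) (x i)); last first.
      by rewrite indicC indicE; case: (_ \in _); rewrite ?subrr ?subr0.
    over.
  by rewrite big_split/= sumr_const card_ord sumrN mulrBr -mulr_natr mul1r mulVf.
rewrite muC empC in emp_ge0 muT0 *.
set a := _ * _; set b := fine _; rewrite -/a -/b in emp_ge0 muT0.
rewrite (_ : a - b = (1 - b) - (1 - a)); last by ring.
by rewrite (le_trans (ler_normB _ _))// !ger0_norm// addrC.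
Qed.

(** * Measurability of the deviation event *)

Lemma empirical_distE {R : realType} (phi : R -> R) (P : probability (Omega R) R)
    (n : nat) (x : Omega R) (y : R) :
  (`|empirical n x `]-oo, y]%classic - marginal P 0 `]-oo, y]%classic| *
   (phi y)%:E)%E =
  (`|n%:R^-1 * (\sum_(i < n) \1_(`]-oo, y]%classic) (x i)) -
     fine (marginal P 0 `]-oo, y]%classic)| * phi y)%:E.
Proof. by rewrite empirical_mean -[marginal _ _ _]fineK ?fin_num_measure. Qed.

Lemma kolmogorov_dist_right_continuous {R : realType} (phi : R -> R)
    (P : probability (Omega R) R) (n : nat) (x : Omega R) (y : R) :
  continuous phi ->
  (fun u => `|n%:R^-1 * (\sum_(i < n) \1_(`]-oo, u]%classic) (x i)) -
     fine (marginal P 0 `]-oo, u]%classic)| * phi u) v @[v --> y^'+] -->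
  `|n%:R^-1 * (\sum_(i < n) \1_(`]-oo, y]%classic) (x i)) -
     fine (marginal P 0 `]-oo, y]%classic)| * phi y.
Proof.
move=> phic; apply: cvgM; last exact/cvg_at_right_filter/phic.
apply: cvg_norm; apply: cvgB; last first.
  apply: fine_cvg; rewrite fineK ?fin_num_measure//.
  exact: (@cdf_right_continuous _ _ _ P (@Defs.coord R 0) y).
(* There are only finitely many sample points, so none lies in []y, u]] once [u] is close enough to
   [y]. *)
have near_cst : \forall u \near y^'+, forall i : 'I_n,
    \1_(`]-oo, u]%classic) (x i) = \1_(`]-oo, y]%classic) (x i) :> R.
  apply: filter_forall => i; have [xy|yx] := leP (x i) y.
    near=> u; have yu : y < u by near: u; exact: nbhs_right_gt.
    by rewrite !indicE !mem_set//= in_itv//= (le_trans xy)// ltW.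
  near=> u; have ux : u < x i by near: u; exact: nbhs_right_lt.
  by rewrite !indicE !memNset//= in_itv/=; apply/negP; rewrite -ltNge.
apply: cvg_near_cst; apply: filterS near_cst => u uy.
by congr (_ * _); exact: eq_bigr.
Unshelve. all: by end_near.
Qed.

(* By right continuity the supremum over y is a supremum over the rationals. *)
Lemma measurable_kolmogorov_dist {R : realType} (phi : R -> R)
    (P : probability (Omega R) R) (n : nat) (delta : R) : continuous phi ->
  measurable [set x : Omega R |
    (delta%:E <= kolmogorov_dist phi (empirical n x) (marginal P 0))%E].
Proof.
move=> phic.
pose h (y : R) (x : Omega R) :=
  `|n%:R^-1 * (\sum_(i < n) \1_(`]-oo, y]%classic) (x i)) -
     fine (marginal P 0 `]-oo, y]%classic)| * phi y.
have mh y : measurable_fun setT (h y).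
  apply: measurable_funM => //; apply: measurableT_comp => //.
  apply: measurable_funB => //; apply: measurable_funM => //.
  apply: measurable_sum => i.
  rewrite (_ : (fun x : Omega R => _) = \1_(`]-oo, y]%classic) \o @Defs.coord R i)//.
  by apply: measurableT_comp => //; exact: measurable_indic.
(* An enumeration of the rationals; codes of no rational are sent to 0. *)
pose q (k : nat) : R := ratr (odflt 0 (unpickle k)).
have distE x : kolmogorov_dist phi (empirical n x) (marginal P 0) =
    esups (fun k => (h (q k) x)%:E) 0.
  apply/eqP; rewrite eq_le; apply/andP; split; last first.
    apply: ge_ereal_sup => _ [k _ <-]; apply: ereal_sup_ubound.
    by exists (q k) => //; rewrite empirical_distE.
  apply: ge_ereal_sup => _ [y _ <-]; rewrite empirical_distE.
  set S := esups _ _.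
  have hS k : ((h (q k) x)%:E <= S)%E.
    by apply: ereal_sup_ubound; exists k.
  move: hS; case: S => [s|_|]; [|exact: leey|]; last first.
    by move=> /(_ 0%N); rewrite leeNy_eq.
  move=> hs; rewrite lee_fin leNgt; apply/negP => sh.
  (* A value above the rational supremum [s] at [y] would persist just to the right of [y], hence at
     some rational. *)
  have hright := kolmogorov_dist_right_continuous phi P n x y phic.
  have [e /= e0 He] := cvgr_gt _ hright _ sh.
  have [r] := @rat_in_itvoo _ y (y + e) ltac:(by rewrite ltrDl).
  rewrite in_itv/= => /andP[yr rye].
  have := He (ratr r); rewrite /= => /(_ _ yr).
  have := hs (pickle r); rewrite /q pickleK/= lee_fin leNgt => /negP nlt lt.
  apply: nlt.
  apply: lt => //.
  rewrite ltr_distlC; apply/andP; split => //.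
  by rewrite (lt_trans _ yr)// ltrBlDr ltrDl.
rewrite -[X in measurable X]setTI; under eq_set do rewrite distE.
apply: emeasurable_fun_c_infty => //.
apply: measurable_fun_esups => k; exact/measurable_EFinP.
Qed.

(** * Markov's inequality and the mixing bound *)

(** As the marginals agree, the average of [g] has under [P] the same expectation as [g] under the
    first marginal, possibly infinite. *)
Lemma mean_markov {R : realType} (P : probability (Omega R) R) (g : R -> R)
    (t : R) (n : nat) :
  (forall (i j : nat) (A : set R), measurable A ->
     marginal P i A = marginal P j A) ->
  measurable_fun setT g -> (forall y, 0 <= g y) -> 0 < t -> (0 < n)%N ->
  (P [set x : Omega R | t <= n%:R^-1 * \sum_(i < n) g (x i)]%R <=
    (t^-1)%:E * \int[marginal P 0]_y (g y)%:E)%E.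
Proof.
move=> stat mg g0 t0 n0.
have nV0 : 0 <= n%:R^-1 :> R by rewrite invr_ge0.
have mX i : measurable_fun setT (g \o @Defs.coord R i).
  by apply: measurableT_comp.
pose S (x : Omega R) : R := n%:R^-1 * \sum_(i < n) g (x i).
have S0 x : 0 <= S x by rewrite mulr_ge0// sumr_ge0.
have mS : measurable_fun setT S.
  by apply: measurable_funM => //; apply: measurable_sum => i; exact: mX.
have ES : (\int[P]_x (S x)%:E = \int[marginal P 0]_y (g y)%:E)%E.
  under eq_integral do rewrite /S EFinM -sumEFin.
  rewrite ge0_integralZl//; last 2 first.
  - apply: emeasurable_sum => i; apply/measurable_EFinP; exact: (mX i).
  - by move=> x _; rewrite sumEFin lee_fin sumr_ge0.
  rewrite ge0_integral_sum//; last 2 first.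
  - by move=> i; apply/measurable_EFinP; exact: (mX i).
  - by move=> i x _; rewrite lee_fin.
  have Eg i : (\int[P]_x (g (x i))%:E = \int[marginal P 0]_y (g y)%:E)%E.
    have mEg : measurable_fun setT (EFin \o g) by exact/measurable_EFinP.
    have Eg0 y : (0 <= (EFin \o g) y)%E by rewrite lee_fin.
    have <- := @ge0_integral_distribution _ _ _ _ _ P (@Defs.coord R i) _ mEg Eg0.
    by apply: eq_measure_integral => A mA _; exact: stat.
  under eq_bigr do rewrite Eg.
  rewrite sumr_const card_ord; set I := integral _ _ _.
  rewrite (_ : (I *+ n)%R = (n%:R%:E * I)%E); last by rewrite mule_natl.
  by rewrite muleA -EFinM mulVf ?mul1e// pnatr_eq0 -lt0n.
rewrite -ES lee_pdivlMl//.
have mES : measurable_fun setT (EFin \o S) by exact/measurable_EFinP.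
have := @le_integral_abse _ _ _ P setT measurableT (EFin \o S) t mES t0.
rewrite setTI; under eq_integral do rewrite /= ger0_norm//.
by under eq_set do rewrite /= ger0_norm// lee_fin.
Qed.

Lemma covariance_le_alpha_mixing {R : realType} (P : probability (Omega R) R)
    (i j : nat) (A B : set R) : (i <= j)%N -> measurable A -> measurable B ->
  (P (Defs.coord i @^-1` A `&` Defs.coord j @^-1` B) -
   P (Defs.coord i @^-1` A) * P (Defs.coord j @^-1` B) <=
   alpha_mixing P (j - i))%E.
Proof.
move=> ij mA mB; apply: le_trans (lee_abs _) _.
have mem_sigma l (I : set nat) C : I l -> measurable C ->
    sigma_coord R I (@Defs.coord R l @^-1` C).
  move=> Il mC; apply: sub_sigma_algebra; exists l => //; exists C => //.
  by rewrite setTI.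
(* With 0-based coordinates, [i] belongs to the past for [k = i.+1], and [j] is the first coordinate
   of the future at lag [j - i]. *)
apply: le_trans (ereal_sup_ubound _); last by exists i.+1.
apply: ereal_sup_ubound; exists (@Defs.coord R i @^-1` A).
  by apply: mem_sigma => //=.
exists (@Defs.coord R j @^-1` B) => //; apply: mem_sigma => //=.
by rewrite addSn subnKC.
Qed.

(** * Bracketing and the quantitative estimate *)

(** With [j] the integer part of [m * F y], the ray at [y] lies between [V j] and [U j.+1], where
    [mu (V j)] exceeds [F y - 1/m] and [mu (U j.+1)] is at most [F y + 1/m]. As [F y = 1] gives
    [j = m], the index [j.+1] can reach [m.+1]. *)
Lemma bracketed_dist {R : realType} (F : R -> R) (G mu : set R -> R) (m : nat)
    (eta : R) (U V : nat -> set R) :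
  (0 < m)%N -> (forall A B, A `<=` B -> G A <= G B) ->
  (forall y, 0 <= F y <= 1) ->
  (forall j, mu (U j) <= j%:R / m%:R) ->
  (forall j, (j <= m)%N -> j%:R / m%:R <= mu (V j)) ->
  (forall j y, F y < j%:R / m%:R -> `]-oo, y]%classic `<=` U j) ->
  (forall j y, j%:R / m%:R <= F y -> V j `<=` `]-oo, y]%classic) ->
  (forall j, (j < m.+2)%N -> `|G (U j) - mu (U j)| < eta) ->
  (forall j, (j < m.+2)%N -> `|G (V j) - mu (V j)| < eta) ->
  forall y, `|G `]-oo, y]%classic - F y| <= eta + m%:R^-1.
Proof.
move=> m0 Gmono F01 muU muV FU FV GU GV y.
have mR0 : 0 < m%:R :> R by rewrite ltr0n.
have /andP[F0 F1] := F01 y.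
have mF0 : 0 <= m%:R * F y by rewrite mulr_ge0// ltW.
pose j := Num.truncn (m%:R * F y).
have /andP[jF Fj] := truncn_itv mF0; rewrite -/j in jF Fj.
have jm : (j <= m)%N.
  by rewrite -(ler_nat R) (le_trans jF)// ger_pMr.
have {}jF : j%:R / m%:R <= F y by rewrite ler_pdivrMr// mulrC.
have {}Fj : F y < j.+1%:R / m%:R by rewrite ltr_pdivlMr// mulrC.
have step : j.+1%:R / m%:R = j%:R / m%:R + m%:R^-1 :> R.
  by rewrite -natr1 mulrDl mul1r.
have GU1 := Gmono _ _ (FU _ _ Fj); have GV1 := Gmono _ _ (FV _ _ jF).
have := GU j.+1 _; rewrite !ltnS => /(_ jm); rewrite ltr_norml => /andP[_ ubU].
have := GV j _; rewrite !ltnS => /(_ (leqW jm)); rewrite ltr_norml => /andP[lbV _].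
have muUj := muU j.+1; have muVj := muV j jm.
rewrite ler_norml; apply/andP; split; lra.
Qed.

(** A union bound with constants independent of [P]: one Markov term for the tail average, and one
    weak-law term for each of the two families of [m.+2] rays. *)
Lemma prob_kolmogorov_dist_le {R : realType} (phi : R -> R)
    (P : probability (Omega R) R) (K eta tau delta e : R) (N m n : nat) :
  u_shaped phi ->
  (forall (i j : nat) (A : set R), measurable A ->
     marginal P i A = marginal P j A) ->
  (\int[marginal P 0]_y (upper_part phi K y)%:E <= tau%:E)%E ->
  (forall k, (N <= k)%N -> (alpha_mixing P k <= e%:E)%E) ->
  0 <= e -> 0 < eta -> 0 < delta -> (0 < m)%N -> (0 < n)%N ->
  tau <= delta / 4 -> (eta + m%:R^-1) * K <= delta / 2 ->
  (P [set x : Omega R |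
       (delta%:E <= kolmogorov_dist phi (empirical n x) (marginal P 0))%E] <=
   ((delta / 4)^-1 * tau +
    (m.+2).*2%:R * ((e + N.*2%:R / n%:R) / eta ^+ 2))%:E)%E.
Proof.
move=> phiU stat int_tau mix e0 eta0 delta0 m0 n0 tau_delta etaK.
have [phic phi1 _ _] := phiU.
have phi0 y : 0 <= phi y by exact: le_trans (phi1 y).
pose mu A := fine (marginal P 0 A).
have muE A : measurable A -> marginal P 0 A = (mu A)%:E.
  by move=> mA; rewrite fineK// fin_num_measure.
pose emp (x : Omega R) (A : set R) : R := n%:R^-1 * \sum_(i < n) \1_A (x i).
have emp_mono x A B : A `<=` B -> emp x A <= emp x B.
  move=> AB; rewrite ler_wpM2l ?invr_ge0//; apply: ler_sum => i _.
  rewrite !indicE ler_nat; have [/set_mem/AB/mem_set->//|//] := boolP (_ \in A).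
have /choice[UV HUV] (j : nat) : exists UV : set R * set R,
   [/\ measurable UV.1 /\ measurable UV.2,
    mu UV.1 <= j%:R / m%:R,
    (j <= m)%N -> j%:R / m%:R <= mu UV.2,
    forall y, mu `]-oo, y]%classic < j%:R / m%:R -> `]-oo, y]%classic `<=` UV.1 &
    forall y, j%:R / m%:R <= mu `]-oo, y]%classic -> UV.2 `<=` `]-oo, y]%classic].
  have c0 : 0 <= j%:R / m%:R :> R by rewrite divr_ge0.
  have [U [V [[mU mV] PU PV IU IV]]] :=
    @cdf_quantile_bracket _ _ _ P (@Defs.coord R 0) _ c0.
  exists (U, V); split => //=.
  - by rewrite -lee_fin -muE.
  - move=> jm; rewrite -lee_fin -muE//; apply: PV.
    by rewrite ler_pdivrMr ?ltr0n// mul1r ler_nat.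
  - by move=> y; rewrite -lte_fin -muE//; exact: IU.
  - by move=> y; rewrite -lee_fin -muE//; exact: IV.
pose bad A := [set x : Omega R | eta <= `|emp x A - mu A|].
pose tail := [set x : Omega R |
  delta / 4 <= n%:R^-1 * \sum_(i < n) upper_part phi K (x i)].
have mean_measurable (f : R -> R) : measurable_fun setT f ->
    measurable_fun setT (fun x : Omega R => n%:R^-1 * \sum_(i < n) f (x i)).
  move=> mf; apply: measurable_funM => //; apply: measurable_sum => i.
  rewrite (_ : (fun x : Omega R => _) = f \o @Defs.coord R i)//.
  exact: measurableT_comp.
have mbad A : measurable A -> measurable (bad A).
  move=> mA; rewrite -[X in measurable X]setTI.
  apply: measurable_fun_le => //; apply: measurableT_comp => //.
  by apply: measurable_funB => //; apply: mean_measurable; exact: measurable_indic.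
have mupper : measurable_fun setT (upper_part phi K) by exact: measurable_upper_part.
have mtail : measurable tail.
  rewrite -[X in measurable X]setTI.
  by apply: measurable_fun_le => //; exact: mean_measurable.
pose b := (e + N.*2%:R / n%:R) / eta ^+ 2.
have Pbad A : measurable A -> (P (bad A) <= b%:E)%E.
  move=> mA.
  apply: (@weak_law_indic _ _ _ P (fun i => @Defs.coord R i @^-1` A)) => //.
  - by move=> i; rewrite -[X in measurable X]setTI; exact: measurable_coord.
  - by move=> i; rewrite -muE//; exact: stat.
  - move=> i j ij; have ij' : (i <= j)%N by rewrite (leq_trans _ ij)// leq_addr.
    apply: le_trans (covariance_le_alpha_mixing P _ _ _ _ ij' mA mA) (mix _ _).
    by rewrite leq_subRL.
pose E1 := \big[setU/set0]_(j < m.+2) bad (UV j).1.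
pose E2 := \big[setU/set0]_(j < m.+2) bad (UV j).2.
have mE1 : measurable E1.
  by apply: bigsetU_measurable => j _; apply: mbad; case: (HUV j) => -[].
have mE2 : measurable E2.
  by apply: bigsetU_measurable => j _; apply: mbad; case: (HUV j) => -[].
have PE (W : nat -> set R) : (forall j, measurable (W j)) ->
    (P (\big[setU/set0]_(j < m.+2) bad (W j)) <= (m.+2%:R * b)%:E)%E.
  move=> mW; have mbW j : (j < m.+2)%N -> measurable (bad (W j)).
    by move=> _; exact: mbad.
  apply: (le_trans (Boole_inequality P mbW)).
  apply: (@le_trans _ _ (\sum_(j < m.+2) b%:E)%E).
    by apply: lee_sum => j _; exact: Pbad.
  by rewrite sumEFin sumr_const card_ord mulr_natl.
apply: (@le_trans _ _ (P (tail `|` (E1 `|` E2)))).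
  apply: le_measure; rewrite ?inE//.
  - exact: measurable_kolmogorov_dist.
  - by apply: measurableU => //; exact: measurableU.
  (* Off the exceptional events the distance is at most [delta / 2], which is strictly below
     [delta]. *)
  move=> x /=; apply: contraPP => /not_orP[ntail /not_orP[nE1 nE2]].
  apply/negP; rewrite -ltNge; apply: (@le_lt_trans _ _ (delta / 2)%:E); last first.
    by rewrite lte_fin; lra.
  move: ntail => /negP; rewrite -ltNge => mean_lt.
  have good (W : nat -> set R) : ~ (\big[setU/set0]_(j < m.+2) bad (W j)) x ->
      forall j, (j < m.+2)%N -> `|emp x (W j) - mu (W j)| < eta.
    rewrite -(bigcup_mkord _ (fun j => bad (W j))) => nW j jm.
    rewrite ltNge; apply/negP => badj.
    by apply: nW; exists j.
  have unif := bracketed_dist (fun y => mu `]-oo, y]%classic) (emp x) mu m eta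
    (fun j => (UV j).1) (fun j => (UV j).2) m0 (emp_mono x).
  (* Where [K <= phi y], the bound is [delta / 4 + tau]; elsewhere it is [(eta + 1/m) * K]. *)
  apply: ge_ereal_sup => _ [y _ <-]; have [Ky|yK] := leP K (phi y).
    apply: le_trans (le_cdf_dist_tail phi (marginal P 0) K y n x phiU n0 Ky) _.
    apply: le_trans (leeD (lexx _) int_tau) _.
    by rewrite -EFinD lee_fin; lra.
  rewrite empirical_distE lee_fin; apply: le_trans etaK.
  apply: ler_pM => //; last exact: ltW.
  apply: unif.
  - by move=> z; rewrite fine_ge0//= -lee_fin -muE// probability_le1.
  - by move=> j; case: (HUV j).
  - by move=> j; case: (HUV j).
  - by move=> j; case: (HUV j).
  - by move=> j; case: (HUV j).
  - exact: good.
  - exact: good.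
apply: (le_trans (measureU2 _ mtail (measurableU _ _ mE1 mE2))).
rewrite EFinD; apply: leeD.
  have quarter0 : 0 < delta / 4 by rewrite divr_gt0.
  apply: le_trans (mean_markov P _ _ _ stat mupper _ quarter0 n0) _.
    by move=> y; rewrite /upper_part mulr_ge0.
  by rewrite EFinM; apply: lee_wpmul2l => //; rewrite lee_fin invr_ge0 ltW.
apply: (le_trans (measureU2 _ mE1 mE2)).
rewrite -/b -addnn natrD mulrDl EFinD; apply: leeD.
  by apply: (PE (fun j => (UV j).1)) => j; case: (HUV j) => -[].
by apply: (PE (fun j => (UV j).2)) => j; case: (HUV j) => -[].
Qed.

(** * Extended-real limits and the choice of constants *)

Lemma cvge0_near_le {R : realType} {T : Type} (F : set_system T) {FF : Filter F}
    (u : T -> \bar R) (e : R) : 0 < e ->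
  u @ F --> 0%E -> \forall x \near F, (u x <= e%:E)%E.
Proof.
move=> e0 /fine_cvgP[ufin u0]; near=> x.
rewrite -[u x]fineK; last by near: x.
by rewrite lee_fin; apply: ltW; near: x; exact: (cvgr_lt _ u0).
Unshelve. all: by end_near.
Qed.

Lemma near_le_cvge0 {R : realType} {T : Type} (F : set_system T) {FF : Filter F}
    (u : T -> \bar R) : (forall x, 0 <= u x)%E ->
  (forall e : R, 0 < e -> \forall x \near F, (u x <= e%:E)%E) -> u @ F --> 0%E.
Proof.
move=> u0 ue; apply/fine_cvgP; split.
  apply: filterS (ue 1 ltr01) => x ux1.
  by rewrite ge0_fin_numE// (le_lt_trans ux1)// ltry.
apply/cvgr0Pnorm_le => e e0; apply: filterS (ue e e0) => x uxe.
rewrite ger0_norm ?fine_ge0//= -lee_fin fineK//.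
by rewrite ge0_fin_numE// (le_lt_trans uxe)// ltry.
Qed.

Theorem theorem3p1 (R : realType) (phi : R -> R)
    (PP : set (probability (Omega R) R)) :
  u_shaped phi ->
  (forall P, PP P -> forall (i j : nat) (A : set R), measurable A ->
     marginal P i A = marginal P j A) ->
  ereal_sup [set (\int[marginal P 0]_y
                    (phi y * \1_[set z | K <= phi z] y)%:E)%E | P in PP]
    @[K --> +oo] --> 0%E ->
  ereal_sup [set alpha_mixing P n | P in PP] @[n --> \oo] --> 0%E ->
  forall delta : R, 0 < delta ->
  ereal_sup [set P [set x : Omega R |
                    (delta%:E <=
                       kolmogorov_dist phi (empirical n x) (marginal P 0))%E]
            | P in PP]
    @[n --> \oo] --> 0%E.
Proof.
move=> phiU stat unif_int mixing delta delta0.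
(* An empty class would have supremum -oo, which does not tend to 0. *)
have [P0 PP0] : PP !=set0.
  apply/set0P/negP => /eqP PP0; move: mixing; rewrite PP0.
  under eq_fun do rewrite image_set0 ereal_sup0.
  move=> /fine_cvgP[/= [n _ /(_ n (leqnn n))]].
  by rewrite /= fin_numE.
apply: near_le_cvge0 => [n|eps eps0].
  by apply: ereal_sup_ge; exists (P0 [set x : Omega R |
    (delta%:E <= kolmogorov_dist phi (empirical n x) (marginal P0 0))%E]);
    [exists P0|].
(* The first entry serves the bound [delta / 4 + tau], the second makes the Markov term at most
   [eps / 2]. The constants [tau], [K], [eta], [m], [e], [N] are chosen in this order, none
   depending on [P]. *)
pose tau := Num.min (delta / 4) (delta * eps / 8).
have tau0 : 0 < tau by rewrite lt_min !divr_gt0// mulr_gt0.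
have [K K1 tailK] : exists2 K : R, 1 <= K &
    (ereal_sup [set (\int[marginal P 0]_y
      (phi y * \1_[set z | K <= phi z] y)%:E)%E | P in PP] <= tau%:E)%E.
  have near1 : \forall K \near +oo, (1 : R) <= K by exact: nbhs_pinfty_ge.
  have near_tau := cvge0_near_le _ _ _ tau0 unif_int.
  have [K [K1 Ktau]] := filter_ex (filterI near1 (near_tau _)).
  by exists K.
have K0 : 0 < K by exact: lt_le_trans ltr01 K1.
(* Together with [1/m <= eta] this gives [(eta + 1/m) * K <= delta / 4]. *)
pose eta := delta / (8 * K).
have eta0 : 0 < eta by rewrite divr_gt0// mulr_gt0.
pose m := (Num.truncn eta^-1).+1.
have m_eta : m%:R^-1 <= eta.
  rewrite -[eta]invrK lef_pV2 ?posrE ?invr_gt0 ?ltr0n//.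
  by apply: ltW; exact: truncnS_gt.
pose M : R := (m.+2).*2%:R.
have M0 : 0 < M by rewrite ltr0n.
(* Chosen so that [M * ((e + e) / eta ^ 2) = eps / 2]; the second [e] will absorb [N.*2 / n] for
   large [n]. *)
pose e := eps * eta ^+ 2 / (4 * M).
have e0 : 0 < e.
  by rewrite /e divr_gt0//; apply: mulr_gt0 => //; exact: exprn_gt0.
have [N _ mixN] := cvge0_near_le _ _ _ e0 mixing.
near=> n.
have n0 : (0 < n)%N by near: n; exact: nbhs_infty_gt.
have nN : N.*2%:R / n%:R <= e.
  rewrite ler_pdivrMr ?ltr0n// mulrC -ler_pdivrMr//.
  by near: n; exact: nbhs_infty_ger.
apply: ge_ereal_sup => _ [P PPP <-].
have int_tau : (\int[marginal P 0]_y (upper_part phi K y)%:E <= tau%:E)%E.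
  by apply: le_trans tailK; apply: ereal_sup_ubound; exists P.
have mixP k : (N <= k)%N -> (alpha_mixing P k <= e%:E)%E.
  by move=> Nk; apply: le_trans (mixN k Nk); apply: ereal_sup_ubound; exists P.
have tau_delta : tau <= delta / 4 by rewrite ge_min lexx.
have etaK : (eta + m%:R^-1) * K <= delta / 2.
  apply: (@le_trans _ _ ((eta + eta) * K)).
    by rewrite ler_wpM2r ?lerD2l// ltW.
  rewrite (_ : (eta + eta) * K = delta / 4); last first.
    by rewrite /eta; field; rewrite gt_eqF.
  lra.
apply: le_trans (prob_kolmogorov_dist_le _ _ _ _ _ _ _ N m n phiU (stat P PPP)
  int_tau mixP (ltW e0) eta0 delta0 (ltn0Sn _) n0 tau_delta etaK) _.
rewrite lee_fin [leRHS]splitr lerD//.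
  rewrite ler_pdivrMl ?divr_gt0//.
  rewrite (_ : delta / 4 * (eps / 2) = delta * eps / 8); last by field.
  by rewrite ge_min lexx orbT.
rewrite -/M (_ : eps / 2 = M * ((e + e) / eta ^+ 2)); last first.
  by rewrite /e; field; rewrite !gt_eqF.
by rewrite ler_pM2l// ler_pM2r ?invr_gt0 ?exprn_gt0// lerD2l.
Unshelve. all: by end_near.
Qed.
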